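(* Let $(\mathcal G,N,M,\mathbf u)$ be an admissible instance (see context). Let $\mathcal{CZ}$ be the set of all $\mathbf z\in\mathbb R^{|\mathcal V|}$ with $\mathbf z\ge\mathbf 0$ satisfying $z_i\le u_i$ for all $i\in\mathcal V$, $z_i-z_j\le0$ for all $(i,j)\in\mathcal A$, and $$-z_{\mathrm{ch}(\psi)}+\frac{z_\psi}{u_\psi-\lfloor u_\psi\rfloor}\le\frac{\lfloor u_\psi\rfloor(\lceil u_\psi\rceil-u_\psi)}{u_\psi-\lfloor u_\psi\rfloor}\qquad\text{for all }\psi\in\Psi.$$ Then $\mathcal{CZ}=\mathrm{conv}(\mathcal Z(\mathcal G,\mathbf u))$.
   Context: $\mathcal V=\{1,\dots,n+m\}$ is partitioned into $N$ (indices of integer variables) and $M$ (indices of continuous variables); either may be empty. $\mathcal G=(\mathcal V,\mathcal A)$ is a directed rooted forest: a disjoint union of directed rooted trees with all arcs pointing away from the roots. $R^+(i)$ is the set of vertices reachable from $i$ along arcs, including $i$. For $\mathbf u\in\mathbb R^{|\mathcal V|}$, $\mathcal Z(\mathcal G,\mathbf u)=\{\mathbf z\in\mathbb R^{|\mathcal V|}: z_i\in\mathbb Z\ (i\in N),\ \mathbf 0\le\mathbf z\le\mathbf u,\ z_i\le z_j\ \forall(i,j)\in\mathcal A\}$ and $\Psi=\{\psi\in\mathcal V:u_\psi\notin\mathbb Z,\ R^+(\psi)\cap N\ne\emptyset\}$. The instance is *admissible* if: (a) $0<u_i<\infty$ for all $i$, $u_i\in\mathbb Z$ for $i\in N$,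 and $u_i\le u_j$ for $(i,j)\in\mathcal A$; (b) every directed path of $\mathcal G$ contains at most one vertex of $\Psi$; (c) every $\psi\in\Psi$ has exactly one child, denoted $\mathrm{ch}(\psi)$, and $\mathrm{ch}(\psi)\in N$, $u_{\mathrm{ch}(\psi)}=\lceil u_\psi\rceil$. *)

(* Defs.v *)
From mathcomp Require Import all_boot all_order all_algebra.
From mathcomp Require Import classical_sets reals.

Set Implicit Arguments.
Unset Strict Implicit.
Unset Printing Implicit Defensive.

Import Order.TTheory GRing.Theory Num.Theory.

Local Open Scope ring_scope.

Section Forest.

Variables (V : finType) (A : rel V).

(* [i :: p] is a simple path from [i] to [j] in the underlying undirected graph
   of [A] restricted to [C]. *)
Definition undirected_path (C : {set V}) (i : V) (p : seq V) (j : V) : Prop :=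
  [/\ all (mem C) (i :: p), path [rel x y | A x y || A y x] i p,
      uniq (i :: p) & last i p = j].

Definition undirected_tree (C : {set V}) : Prop :=
  {in C &, forall i j, exists! p, undirected_path C i p j}.

(* The arc (i, j) points away from [r]: the path from [r] to [j] is the path
   from [r] to [i] followed by (i, j). This excludes loops and antiparallel
   arcs. *)
Definition directed_rooted_tree (C : {set V}) : Prop :=
  undirected_tree C /\
  exists2 r, r \in C &
    {in C &, forall i j, A i j -> forall p,
       undirected_path C r p i -> undirected_path C r (rcons p j) j}.

Definition directed_rooted_forest : Prop :=
  exists P : {set {set V}},
    [/\ finset.partition P [set: V],
        forall C, C \in P -> directed_rooted_tree C &
        forall C i j, C \in P -> A i j -> (i \in C) = (j \in C)].

Definition reach (i : V) : {set V} := [set j | connect A i j].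

(* Junk value [i] when [i] has no child; only used at vertices that have exactly
   one child. *)
Definition ch (i : V) : V := odflt i [pick j | A i j].

End Forest.

Section Instance.

Variables (R : realType) (k : nat).
Variables (A : rel 'I_k) (N : {set 'I_k}) (u : 'rV[R]_k).

Definition floorR (x : R) : R := (Num.floor x)%:~R.
Definition ceilR (x : R) : R := (Num.ceil x)%:~R.

Definition calZ : set 'rV[R]_k :=
  [set z : 'rV[R]_k |
     [/\ forall i, i \in N -> z 0 i \is a Num.int,
         forall i, 0 <= z 0 i <= u 0 i &
         forall i j, A i j -> z 0 i <= z 0 j]]%classic.

Definition Psi : {set 'I_k} :=
  [set psi | (u 0 psi \isn't a Num.int) && (reach A psi :&: N != finset.set0)].

Definition admissible : Prop :=
  [/\ [/\ forall i, 0 < u 0 i,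
          forall i, i \in N -> u 0 i \is a Num.int &
          forall i j, A i j -> u 0 i <= u 0 j],
      forall i p, path A i p -> uniq (i :: p) ->
        (count (mem Psi) (i :: p) <= 1)%N &
      forall psi, psi \in Psi ->
        [/\ #|[set j | A psi j]| = 1%N, ch A psi \in N &
            u 0 (ch A psi) = ceilR (u 0 psi)]].

Definition CZ : set 'rV[R]_k :=
  [set z : 'rV[R]_k |
     [/\ forall i, 0 <= z 0 i,
         forall i, z 0 i <= u 0 i,
         forall i j, A i j -> z 0 i - z 0 j <= 0 &
         forall psi, psi \in Psi ->
           - z 0 (ch A psi) + z 0 psi / (u 0 psi - floorR (u 0 psi))
           <= floorR (u 0 psi) * (ceilR (u 0 psi) - u 0 psi)
              / (u 0 psi - floorR (u 0 psi))]]%classic.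

Definition conv_hull (S : set 'rV[R]_k) : set 'rV[R]_k :=
  [set z : 'rV[R]_k | exists (l : nat) (w : 'I_l -> R) (x : 'I_l -> 'rV[R]_k),
     [/\ forall t, 0 <= w t, \sum_t w t = 1, forall t, S (x t) &
         z = \sum_t w t *: x t]]%classic.

End Instance.

(* Main.v *)
(* Every z in CZ is the mean of a random point of calZ driven by one threshold
   th, uniform in [0, 1[. The coordinates of integer variables, and more generally of
   vertices with integral bound from which N is reachable, are rounded to
   ceil (z_i - th), which has mean z_i and is monotone in z_i. A vertex psi of
   Psi with z_psi > floor u_psi becomes the affine image of its rounded child
   with mean z_psi; the cut inequality says exactly that this image stays
   below u_psi. A vertex i from which N is unreachable is rounded while z_i lies
   below the integral bound of some ancestor that reaches N, and keeps its
   value z_i once it dominates all these bounds; the unique parent of i sees the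
   same bounds, so this choice is consistent along arcs. Only finitely many values are
   rounded, so the mean over th is a finite convex combination. *)
Require Import Defs.
From mathcomp Require Import all_boot all_order all_algebra.
From mathcomp Require Import classical_sets reals.
From mathcomp Require Import ring lra.

Set Implicit Arguments.
Unset Strict Implicit.
Unset Printing Implicit Defensive.

Import Order.TTheory GRing.Theory Num.Theory.

(** * Unique parents and children in the forest *)

Section Forest.

Variables (V : finType) (A : rel V).

(** Extending by [j] the root paths to [i] and to [i'] gives simple paths from the root to [j]; the
    tree has only one, so both agree before [j]. *)
Lemma forest_parent_unique (forestA : directed_rooted_forest A) (i i' j : V) :
  A i j -> A i' j -> i = i'.
Proof.
move=> Aij Ai'j; case: forestA => P [/and3P[/eqP coverP _ _] treeP closedP].
have: j \in finset.cover P by rewrite coverP inE.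
case/bigcupP=> C CP jC.
have iC : i \in C by rewrite (closedP C i j).
have i'C : i' \in C by rewrite (closedP C i' j).
have [tree [r rC away]] := treeP C CP.
have [p [pP _]] := tree r i rC iC.
have [p' [p'P _]] := tree r i' rC i'C.
have [q [_ uniq_q]] := tree r j rC jC.
have := uniq_q _ (away _ _ iC jC Aij _ pP).
rewrite (uniq_q _ (away _ _ i'C jC Ai'j _ p'P)) => /rcons_inj[pp'].
by case: pP p'P => _ _ _ <- [_ _ _ <-]; rewrite pp'.
Qed.

Lemma connect_parent (forestA : directed_rooted_forest A) (q i j : V) :
  A i j -> connect A q j -> q != j -> connect A q i.
Proof.
move=> Aij /connectP[p]; case/lastP: p => [|p x] /= => [_ ->|]; first by rewrite eqxx.
rewrite rcons_path last_rcons => /andP[pathp Ax] jx _.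
apply/connectP; exists p => //.
by apply: (forest_parent_unique forestA Aij); rewrite jx.
Qed.

Lemma arc_ch (i j : V) : #|[set j | A i j]| = 1%N -> A i j -> j = ch A i.
Proof.
move=> /eqP/cards1P[c /setP cP] Aij; rewrite /ch.
have Ac x : A i x = (x == c) by have := cP x; rewrite !inE.
case: pickP => [x|/(_ j)]; last by rewrite Aij.
by move: Aij; rewrite !Ac => /eqP-> /eqP->.
Qed.

Lemma ch_arc (i : V) : #|[set j | A i j]| = 1%N -> A i (ch A i).
Proof.
move=> /[dup] card1 /eqP/cards1P[c /setP /(_ c)]; rewrite !inE eqxx => Aic.
by rewrite -(arc_ch card1 Aic).
Qed.

End Forest.

(** * Threshold rounding and its finite averages *)

Section Rounding.

Local Open Scope ring_scope.

Variable R : realType.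

Lemma floorR_le (x : R) : floorR x <= x.
Proof. exact: floor_le. Qed.

Lemma floorR_lt (x : R) : x < floorR x + 1.
Proof. by have := floorD1_gt x; rewrite intrD. Qed.

Lemma floorR_nint_lt (x : R) : x \isn't a Num.int -> floorR x < x.
Proof.
move=> xN; rewrite lt_neqAle floorR_le andbT.
by apply: contra xN => /eqP <-; exact: intr_int.
Qed.

Lemma ceilR_nint (x : R) : x \isn't a Num.int -> ceilR x = floorR x + 1.
Proof. by move=> xN; rewrite /ceilR ceil_floor xN intrD. Qed.

Lemma int_le_floorR (x y : R) : x \is a Num.int -> x <= y -> x <= floorR y.
Proof. by move=> /intrP[m ->]; rewrite /floorR ler_int -floor_ge_int. Qed.

Definition threshold_round (th x : R) : R := ceilR (x - th).

Lemma threshold_round_int th x : threshold_round th x \is a Num.int.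
Proof. exact: intr_int. Qed.

Lemma le_threshold_round th : {homo threshold_round th : x y / x <= y}.
Proof. by move=> x y xy; rewrite ler_int le_ceil // lerD2r. Qed.

Lemma threshold_round_le th x y :
  0 <= th -> y \is a Num.int -> x <= y -> threshold_round th x <= y.
Proof.
move=> th0 /intrP[m ->] xm; rewrite ler_int ceil_le_int; lra.
Qed.

Lemma threshold_round_ge th x y :
  th < 1 -> y \is a Num.int -> y <= x -> y <= threshold_round th x.
Proof.
move=> th1 /intrP[m ->] mx; rewrite ler_int -ltzD1 -(ltr_int R) intrD.
have := ceil_ge (x - th); lra.
Qed.

(** Only the comparison of [th] with the fractional part of [x] matters, so averaging roundings
    reduces to averaging indicators. *)
Lemma threshold_roundE th x : 0 <= th < 1 ->
  threshold_round th x = floorR x + (th < x - floorR x)%R%:R.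
Proof.
move=> /andP[th0 th1]; have := floorR_le x; have := floorR_lt x => xl xg.
rewrite /threshold_round /ceilR.
case: ltP => h.
  rewrite (@ceil_def _ _ (Num.floor x + 1)) ?intrD //.
  by move: h xl xg; rewrite /floorR; lra.
rewrite (@ceil_def _ _ (Num.floor x)) ?addr0 //.
by move: h xl xg; rewrite intrB /floorR; lra.
Qed.

Lemma sum_steps_below (a : R) (s : seq R) (c : R) : path <%R a s -> c <= a ->
  \sum_(t < size s) (s`_t - (a :: s)`_t) * ((a :: s)`_t < c)%R%:R = 0.
Proof.
move=> sP ca; apply: big1 => t _; rewrite ltNge (le_trans ca) ?mulr0 //.
have: (a :: s)`_t \in a :: s by rewrite mem_nth //= ltnS ltnW.
rewrite inE => /predU1P[->//|]; have /allP h := order_path_min lt_trans sP.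
by move=> /h/ltW.
Qed.

(** The indicator keeps exactly the steps ending at or before [c], and these telescope. *)
Lemma sum_steps (a : R) (s : seq R) (c : R) : path <%R a s -> c \in a :: s ->
  \sum_(t < size s) (s`_t - (a :: s)`_t) * ((a :: s)`_t < c)%R%:R = c - a.
Proof.
elim: s a => [|b s IHs] a sP cin.
  by rewrite big_ord0; move: cin; rewrite inE => /eqP ->; rewrite subrr.
move: cin; rewrite inE => /predU1P[->|cin].
  by rewrite sum_steps_below // subrr.
have /allP lt_a := order_path_min lt_trans sP.
rewrite big_ord_recl /= (IHs b) ?lt_a //; last by case/andP: sP.
by rewrite mulr1 addrC subrKA.
Qed.

(* The nodes are the left endpoints of the intervals into which the values [s]
   cut [0, 1], weighted by the lengths of these intervals. *)
Lemma threshold_quadrature (s : seq R) : {in s, forall c, 0 <= c <= 1} ->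
  exists (l : nat) (w th : 'I_l -> R),
    [/\ forall t, 0 <= w t, \sum_t w t = 1, forall t, 0 <= th t < 1 &
        {in s, forall c, \sum_t w t * (th t < c)%R%:R = c}].
Proof.
(* Adding 1 makes the intervals exhaust [0, 1]; 0 is filtered out because it heads the path. *)
move=> s01; pose r := sort <=%R (undup [seq c <- 1 :: s | 0 < c]).
have memr c : (c \in r) = (0 < c) && (c \in 1 :: s).
  by rewrite mem_sort mem_undup mem_filter.
have rP : path <%R 0 r.
  rewrite path_sortedE; last exact: lt_trans.
  rewrite lt_sorted_uniq_le sort_uniq undup_uniq sort_le_sorted !andbT.
  by apply/allP => c; rewrite memr => /andP[].
have r1 c : c \in r -> c <= 1.
  by rewrite memr inE => /andP[_] /predU1P[->//|/s01/andP[]].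
have step (t : 'I_(size r)) : (0 :: r)`_t < r`_t by apply: (pathP 0 rP).
have th01 (t : 'I_(size r)) : 0 <= (0 :: r)`_t < 1.
  rewrite (lt_le_trans (step t)) ?r1 ?mem_nth // andbT.
  have: (0 :: r)`_t \in 0 :: r by rewrite mem_nth //= ltnS ltnW.
  by rewrite inE => /predU1P[->//|]; rewrite memr => /andP[/ltW].
exists (size r), (fun t => r`_t - (0 :: r)`_t), (fun t => (0 :: r)`_t).
split=> // [t||c cs].
- by rewrite subr_ge0 ltW.
- have in1 : 1 \in 0 :: r by rewrite inE memr mem_head ltr01 orbT.
  rewrite -[RHS]subr0 -(sum_steps rP in1); apply: eq_bigr => t _.
  by have /andP[_ ->] := th01 t; rewrite mulr1.
- have in_c : c \in 0 :: r.
    rewrite inE memr inE cs orbT andbT.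
    by have /andP[] := s01 c cs; rewrite le_eqVlt eq_sym.
  by rewrite (sum_steps rP in_c) subr0.
Qed.

Lemma threshold_round_quadrature (k : nat) (z : 'I_k -> R) :
  exists (l : nat) (w th : 'I_l -> R),
    [/\ forall t, 0 <= w t, \sum_t w t = 1, forall t, 0 <= th t < 1 &
        forall i, \sum_t w t * threshold_round (th t) (z i) = z i].
Proof.
have [|l [w [th [w0 w1 th01 wth]]]] :=
    @threshold_quadrature [seq z i - floorR (z i) | i <- enum 'I_k].
  move=> _ /mapP[i _ ->].
  by have := floorR_le (z i); have := floorR_lt (z i); lra.
exists l, w, th; split=> // i.
under eq_bigr do rewrite threshold_roundE // mulrDr.
rewrite big_split /= -mulr_suml w1 wth; first lra.
by apply: map_f; rewrite mem_enum.
Qed.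

End Rounding.

(** * Cut inequalities and convexity of [CZ] *)

Section Hull.

Local Open Scope ring_scope.

Variables (R : realType) (k : nat).
Variables (A : rel 'I_k) (N : {set 'I_k}) (u : 'rV[R]_k).

(** Clearing the denominator shows the boundary line of the cut: it passes through the point where
    both coordinates equal the floor, and its slope is the fractional part of [u 0 psi]. *)
Lemma Psi_cutE (z : 'rV[R]_k) (psi : 'I_k) :
  u 0 psi \isn't a Num.int ->
  (- z 0 (ch A psi) + z 0 psi / (u 0 psi - floorR (u 0 psi))
     <= floorR (u 0 psi) * (ceilR (u 0 psi) - u 0 psi)
        / (u 0 psi - floorR (u 0 psi))) =
  (z 0 psi - floorR (u 0 psi) <=
     (u 0 psi - floorR (u 0 psi)) * (z 0 (ch A psi) - floorR (u 0 psi))).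
Proof.
move=> uN; rewrite ceilR_nint //.
set f := u 0 psi - _; have f0 : 0 < f by rewrite subr_gt0 floorR_nint_lt.
rewrite ler_pdivlMr // mulrDl divfK ?gt_eqF //.
by apply/idP/idP; rewrite /f; nra.
Qed.

Lemma CZ_convex (l : nat) (w : 'I_l -> R) (x : 'I_l -> 'rV[R]_k) :
  (forall t, 0 <= w t) -> \sum_t w t = 1 -> (forall t, CZ A N u (x t)) ->
  CZ A N u (\sum_t w t *: x t).
Proof.
move=> w0 w1 xCZ.
have sumE i : (\sum_t w t *: x t) 0 i = \sum_t w t * x t 0 i.
  by rewrite summxE; apply: eq_bigr => t _; rewrite mxE.
(* Each inequality defining [CZ] involves at most two coordinates, so this one averaging fact serves
   all four families. *)
have avg_le (a b c : R) (i j : 'I_k) :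
    (forall t, a * x t 0 i + b * x t 0 j <= c) ->
    a * (\sum_t w t *: x t) 0 i + b * (\sum_t w t *: x t) 0 j <= c.
  move=> le_c; rewrite !sumE !mulr_sumr -big_split /= -[c]mul1r -w1 mulr_suml.
  apply: ler_sum => t _; have := ler_wpM2l (w0 t) (le_c t); lra.
split=> [i|i|i j Aij|psi psiP].
- have /(_ _)/wrap[t|] := @avg_le (-1) 0 0 i i; last lra.
  by have [/(_ i)] := xCZ t; lra.
- have /(_ _)/wrap[t|] := @avg_le 1 0 (u 0 i) i i; last lra.
  by have [_ /(_ i)] := xCZ t; lra.
- have /(_ _)/wrap[t|] := @avg_le 1 (-1) 0 i j; last lra.
  by have [_ _ /(_ i j Aij)] := xCZ t; lra.
- set d := u 0 psi - _; set c := (X in _ <= X).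
  have /(_ _)/wrap[t|] := @avg_le (-1) d^-1 c (ch A psi) psi; last lra.
  by have [_ _ _ /(_ psi psiP)] := xCZ t; rewrite -/d -/c; lra.
Qed.

(** * Vertex rounding *)

Definition integral_reach (i : 'I_k) : bool :=
  reach A i :&: N != finset.set0.

(** Bounds grow along arcs, so an integral [u 0 q] above [z 0 i] leaves room below [u 0 i] for
    rounding up. *)
Definition capped (z : 'rV[R]_k) (i : 'I_k) : bool :=
  [exists q, [&& connect A q i, integral_reach q, u 0 q \is a Num.int &
              z 0 i < u 0 q]].

Definition round_vertex (th : R) (z : 'rV[R]_k) (i : 'I_k) : R :=
  if i \in Psi A N u then
    if z 0 i <= floorR (u 0 i) then threshold_round th (z 0 i)
    else floorR (u 0 i) + (z 0 i - floorR (u 0 i))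
           / (z 0 (ch A i) - floorR (u 0 i))
           * (threshold_round th (z 0 (ch A i)) - floorR (u 0 i))
  else if integral_reach i || capped z i then threshold_round th (z 0 i)
  else z 0 i.

Hypothesis forestA : directed_rooted_forest A.
Hypothesis admA : admissible A N u.

Let u_arc i j : A i j -> u 0 i <= u 0 j.
Proof. by have [[_ _ h] _ _] := admA; apply: h. Qed.

Let u_N i : i \in N -> u 0 i \is a Num.int.
Proof. by have [[_ h _] _ _] := admA; apply: h. Qed.

Let psi_nint psi : psi \in Psi A N u -> u 0 psi \isn't a Num.int.
Proof. by rewrite inE => /andP[]. Qed.

Let psi_arc psi j : psi \in Psi A N u -> A psi j -> j = ch A psi.
Proof. by have [_ _ h] := admA; move=> /h[c _ _]; apply: arc_ch. Qed.

Let psi_ch psi : psi \in Psi A N u -> A psi (ch A psi).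
Proof. by have [_ _ h] := admA; move=> /h[c _ _]; apply: ch_arc. Qed.

Let psi_chN psi : psi \in Psi A N u -> ch A psi \in N.
Proof. by have [_ _ h] := admA; move=> /h[]. Qed.

Let u_psi_ch psi : psi \in Psi A N u -> u 0 (ch A psi) = floorR (u 0 psi) + 1.
Proof.
move=> psiP; have [_ _ /(_ _ psiP)[_ _ ->]] := admA.
by rewrite ceilR_nint ?psi_nint.
Qed.

(** * Integral bounds along arcs and validity of the cuts *)

Lemma integral_reach_arc (i j : 'I_k) :
  A i j -> integral_reach j -> integral_reach i.
Proof.
move=> Aij /finset.set0Pn[x]; rewrite !inE => /andP[jx xN].
by apply/finset.set0Pn; exists x; rewrite !inE xN (connect_trans (connect1 Aij)).
Qed.

Lemma integral_reach_N (i : 'I_k) : i \in N -> integral_reach i.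
Proof. by move=> iN; apply/finset.set0Pn; exists i; rewrite !inE connect0. Qed.

Lemma N_notin_Psi (i : 'I_k) : i \in N -> i \notin Psi A N u.
Proof. by move=> /u_N ui; rewrite inE ui. Qed.

Lemma integral_reach_int (i : 'I_k) :
  i \notin Psi A N u -> integral_reach i -> u 0 i \is a Num.int.
Proof.
by rewrite inE -/(integral_reach i) => iPsi iN; move: iPsi; rewrite iN andbT negbK.
Qed.

(** If [i] were in [Psi], its only child [psi] would be in [N] and have an integral bound. *)
Lemma parent_Psi_int (i psi : 'I_k) :
  psi \in Psi A N u -> A i psi -> i \notin Psi A N u /\ u 0 i \is a Num.int.
Proof.
move=> psiP Aip; suff iP : i \notin Psi A N u.
  split=> //; apply: integral_reach_int => //.
  by apply: integral_reach_arc Aip _; move: psiP; rewrite inE => /andP[].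
by apply/negP => iP; move: (N_notin_Psi (psi_chN iP)); rewrite -(psi_arc iP Aip) psiP.
Qed.

Lemma u_connect (i j : 'I_k) : connect A i j -> u 0 i <= u 0 j.
Proof.
move=> /connectP[p pP ->{j}]; elim: p i pP => //= x p IHp i /andP[Aix pP].
exact: le_trans (u_arc Aix) (IHp x pP).
Qed.

Lemma calZ_sub_CZ (z : 'rV[R]_k) : calZ A N u z -> CZ A N u z.
Proof.
move=> [zN z0u zA]; split=> [i|i|i j /zA|psi psiP].
- by have /andP[] := z0u i.
- by have /andP[] := z0u i.
- by rewrite subr_le0.
rewrite Psi_cutE ?psi_nint //.
have zpc := zA _ _ (psi_ch psiP); have /andP[_ zpu] := z0u psi.
have := floorR_lt (u 0 psi); have := floorR_le (u 0 psi).
have /intrP[c cE] := zN _ (psi_chN psiP); rewrite cE in zpc *.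
move: zpc; rewrite /floorR; set f := Num.floor _ => zpc uf fu.
(* The integer [c] skips the open interval between [f] and [f + 1]: below, the cut follows from
   [zpc]; above, from the bound [u 0 psi]. *)
have [cf|fc] := leP c f.
  have : c%:~R <= f%:~R :> R by rewrite ler_int.
  nra.
have : f%:~R + 1 <= c%:~R :> R by rewrite -(intrD R f 1) ler_int lezD1.
nra.
Qed.

(** * Feasibility of the rounded point *)

Lemma round_Psi_high th z psi : 0 <= th < 1 -> CZ A N u z ->
  psi \in Psi A N u -> floorR (u 0 psi) < z 0 psi ->
  [/\ floorR (u 0 psi) <= round_vertex th z psi,
      round_vertex th z psi <= u 0 psi &
      round_vertex th z psi <= threshold_round th (z 0 (ch A psi))].
Proof.
move=> /andP[th0 th1] [z0 zu zA zcut] psiP; have zpc := zA _ _ (psi_ch psiP).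
have := zcut psi psiP; rewrite Psi_cutE ?psi_nint // => cut.
have zcu := zu (ch A psi); have ucE := u_psi_ch psiP.
have fint : floorR (u 0 psi) \is a Num.int by exact: intr_int.
rewrite ltNge /round_vertex psiP => /[dup] zp /negbTE ->.
move: zp cut; rewrite -ltNge; set f := floorR _ in fint ucE * => zp cut.
(* The child's value lies between the integers [f] and [f + 1], hence so does its rounding. *)
have rf : f <= threshold_round th (z 0 (ch A psi)).
  by apply: threshold_round_ge => //; lra.
have rf1 : threshold_round th (z 0 (ch A psi)) <= f + 1.
  by apply: threshold_round_le; rewrite ?rpredD ?rpred1 //; lra.
set r := threshold_round _ _ in rf rf1 *; have zcf : 0 < z 0 (ch A psi) - f by lra.
set g := _ / _; have g0 : 0 <= g by rewrite divr_ge0 //; lra.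
have g1 : g <= 1 by rewrite ler_pdivrMr //; lra.
(* This is the cut, divided by the positive gap [z 0 (ch A psi) - f]. *)
have gf : g <= u 0 psi - f by rewrite ler_pdivrMr.
by split; nra.
Qed.

(** In the high case the affine formula stays hidden: feasibility uses only its three bounds. *)
Variant round_vertex_spec (th : R) (z : 'rV[R]_k) (i : 'I_k) : R -> Type :=
  | RoundPsiHigh of i \in Psi A N u & floorR (u 0 i) < z 0 i &
      floorR (u 0 i) <= round_vertex th z i &
      round_vertex th z i <= u 0 i &
      round_vertex th z i <= threshold_round th (z 0 (ch A i)) :
      round_vertex_spec th z i (round_vertex th z i)
  | RoundPsiLow of i \in Psi A N u & z 0 i <= floorR (u 0 i) :
      round_vertex_spec th z i (threshold_round th (z 0 i))
  | RoundIntegral of i \notin Psi A N u & integral_reach i &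
      u 0 i \is a Num.int :
      round_vertex_spec th z i (threshold_round th (z 0 i))
  | RoundCapped of i \notin Psi A N u & ~~ integral_reach i & capped z i :
      round_vertex_spec th z i (threshold_round th (z 0 i))
  | RoundFree of i \notin Psi A N u & ~~ integral_reach i & ~~ capped z i :
      round_vertex_spec th z i (z 0 i).

Lemma round_vertexP th z i : 0 <= th < 1 -> CZ A N u z ->
  round_vertex_spec th z i (round_vertex th z i).
Proof.
move=> th01 zCZ; have [iP|iP] := boolP (i \in Psi A N u).
  have [zi|zi] := leP (z 0 i) (floorR (u 0 i)).
    by rewrite /round_vertex iP zi; apply: RoundPsiLow.
  by have [] := round_Psi_high th01 zCZ iP zi; apply: RoundPsiHigh.
rewrite /round_vertex (negbTE iP); have [iN|iN] := boolP (integral_reach i).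
  by apply: RoundIntegral => //; apply: integral_reach_int.
have [ci|ci] := boolP (capped z i); first exact: RoundCapped.
exact: RoundFree.
Qed.

Lemma round_vertex_ge0 th z i :
  0 <= th < 1 -> CZ A N u z -> 0 <= round_vertex th z i.
Proof.
move=> th01 zCZ; have [z0 _ _ _] := zCZ; have /andP[th0 th1] := th01.
have r0 : 0 <= threshold_round th (z 0 i) by apply: threshold_round_ge.
case: (round_vertexP i th01 zCZ) => // _ _ fX _ _; apply: le_trans fX.
by rewrite int_le_floorR // ltW //; have [[]] := admA.
Qed.

Lemma round_vertex_le th z i :
  0 <= th < 1 -> CZ A N u z -> round_vertex th z i <= u 0 i.
Proof.
move=> th01 zCZ; have [_ zu _ _] := zCZ; have /andP[th0 th1] := th01.
case: (round_vertexP i th01 zCZ) => // [_ zi|_ _ ui|_ _].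
- apply: le_trans (floorR_le _); apply: threshold_round_le => //.
  exact: intr_int.
- exact: threshold_round_le.
case/existsP=> q /and4P[qi _ uq ziq]; apply: le_trans (u_connect qi).
by apply: threshold_round_le => //; apply: ltW.
Qed.

Lemma round_vertex_arc th z i j :
  0 <= th < 1 -> CZ A N u z -> A i j -> round_vertex th z i <= round_vertex th z j.
Proof.
move=> th01 zCZ Aij; have [_ zu zA _] := zCZ; have /andP[th0 th1] := th01.
have zij : z 0 i <= z 0 j by rewrite -subr_le0 zA.
have rij := le_threshold_round th zij.
have psi_reach x : x \in Psi A N u -> integral_reach x.
  by rewrite inE => /andP[].
have arcN := integral_reach_arc Aij.
(* The capping ancestor reaches [N] while [j] does not, so it differs from [j] and reaches it
   through its unique parent [i]. *)
have capped_i : ~~ integral_reach j -> capped z j -> capped z i.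
  move=> jN /existsP[q /and4P[qj qN uq zjq]]; apply/existsP; exists q.
  rewrite qN uq (le_lt_trans zij) // !andbT.
  by apply: (connect_parent forestA Aij qj); apply: contraNneq jN => <-.
have uncapped_j q : ~~ capped z j -> connect A q j -> integral_reach q ->
    u 0 q \is a Num.int -> u 0 q <= z 0 j.
  move=> /existsPn/(_ q) + qj qN uq.
  by rewrite qj qN uq /= -leNgt.
case: (round_vertexP j th01 zCZ) => [jP zj fj _ _|jP zj|jP jN uj|jP jN cj|jP jN cj].
(* The integral bound of [i] is at most [u 0 j], hence at most its floor, which the rounding of [j]
   dominates. *)
- have [iP ui] := parent_Psi_int jP Aij; apply: le_trans fj.
  apply: le_trans (round_vertex_le i th01 zCZ) _.
  by apply: int_le_floorR => //; apply: u_arc.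
all: case: (round_vertexP i th01 zCZ) => [iP _ _ _ Xi|iP _|_ iN ui|_ iN ci|_ iN ci] //.
all: try by move: Xi; rewrite -(psi_arc iP Aij).
all: try by case/negP: iN; apply: arcN; first [done | exact: psi_reach].
- by move: ci; rewrite capped_i.
(* As the child of a [Psi] vertex, [j] would be in [N], so it cannot be free. *)
- by case/negP: jN; rewrite (psi_arc iP Aij) integral_reach_N ?psi_chN.
- by case/negP: jN; rewrite (psi_arc iP Aij) integral_reach_N ?psi_chN.
(* A free [j] keeps a value that dominates the bound of [i]; in the next case it dominates the bound
   capping [i]. *)
- apply: le_trans (uncapped_j i cj (connect1 Aij) iN ui).
  by apply: threshold_round_le.
case/existsP: ci => q /and4P[qi qN uq ziq].
apply: le_trans (uncapped_j q cj (connect_trans qi (connect1 Aij)) qN uq).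
by apply: threshold_round_le => //; apply: ltW.
Qed.

Lemma round_vertex_calZ th z :
  0 <= th < 1 -> CZ A N u z -> calZ A N u (\row_i round_vertex th z i).
Proof.
move=> th01 zCZ; split=> [i iN|i|i j Aij]; rewrite !mxE.
- rewrite /round_vertex (negbTE (N_notin_Psi iN)) integral_reach_N //.
  exact: threshold_round_int.
- by rewrite round_vertex_ge0 ?round_vertex_le.
- exact: round_vertex_arc.
Qed.

(** * Means of the rounded coordinates and the hull *)

Lemma round_vertex_mean (l : nat) (w th : 'I_l -> R) z i :
  CZ A N u z -> \sum_t w t = 1 ->
  (forall j, \sum_t w t * threshold_round (th t) (z 0 j) = z 0 j) ->
  \sum_t w t * round_vertex (th t) z i = z 0 i.
Proof.
move=> [_ _ zA _] w1 wth; rewrite /round_vertex.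
(* The branch depends on [z] alone, so all thresholds share it, and each branch is constant or
   affine in a threshold rounding. *)
have [iP|_] := boolP (i \in Psi A N u); last first.
  by case: (integral_reach i || _) => //; rewrite -mulr_suml w1 mul1r.
have [//|] := leP (z 0 i) (floorR (u 0 i)); move: (floorR _) => f zi.
set g := _ / _; have gE : g * (z 0 (ch A i) - f) = z 0 i - f.
  have zpc := zA _ _ (psi_ch iP); rewrite divfK // gt_eqF // subr_gt0.
  by apply: lt_le_trans zi _; rewrite -subr_le0.
transitivity (f + g * (z 0 (ch A i) - f)); last by rewrite gE addrC subrK.
transitivity (\sum_t (w t * (f - g * f)
                + g * (w t * threshold_round (th t) (z 0 (ch A i))))).
  by apply: eq_bigr => t _; move: (threshold_round _ _) g {gE} => r g; ring.
by rewrite big_split /= -mulr_suml w1 -mulr_sumr wth; move: g {gE} => g; ring.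
Qed.

Lemma CZ_sub_hull z : CZ A N u z -> conv_hull (calZ A N u) z.
Proof.
move=> zCZ.
(* One quadrature serves all coordinates: each node rounds the whole vector with a common
   threshold. *)
have [l [w [th [w0 w1 th01 wth]]]] := threshold_round_quadrature (z 0).
exists l, w, (fun t => \row_i round_vertex (th t) z i); split=> // [t|].
  exact: round_vertex_calZ.
apply/rowP => i; rewrite summxE -[LHS](round_vertex_mean _ zCZ w1 wth).
by apply: eq_bigr => t _; rewrite !mxE.
Qed.

End Hull.

Theorem theorem4p21 (R : realType) (n m : nat) (N M : {set 'I_(n + m)})
    (A : rel 'I_(n + m)) (u : 'rV[R]_(n + m)) :
  N :|: M = [set: 'I_(n + m)] -> [disjoint N & M] ->
  directed_rooted_forest A ->
  admissible A N u ->
  CZ A N u = conv_hull (calZ A N u).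
Proof.
move=> _ _ forestA admA; apply/seteqP; split=> z.
  exact: CZ_sub_hull.
move=> [l [w [x [w0 w1 xZ ->]]]]; apply: CZ_convex => // t.
exact: calZ_sub_CZ.
Qed.
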